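(* Let $N\geq 1$. For every proper lower-semicontinuous convex function $f:\mathbb{R}^N\to(-\infty,+\infty]$ and every real $\lambda\geq 0$, $$\operatorname{prox}_{\lambda f}=\left(\lambda\operatorname{prox}_f^{-1}+(1-\lambda)\operatorname{Id}\right)^{-1}.$$
   Context: $\operatorname{Id}$ is the identity operator on $\mathbb{R}^N$. For a proper function $f$, $\operatorname{prox}_f(\boldsymbol{x})=\operatorname{argmin}_{\boldsymbol{u}\in\mathbb{R}^N}\{f(\boldsymbol{u})+\frac12\|\boldsymbol{u}-\boldsymbol{x}\|_2^2\}$; it is viewed as a set-valued operator $\mathbb{R}^N\to 2^{\mathbb{R}^N}$. The inverse of a set-valued operator $A:\mathbb{R}^N\to 2^{\mathbb{R}^N}$ is the set-valued operator $A^{-1}\boldsymbol{u}=\{\boldsymbol{x}\in\mathbb{R}^N : \boldsymbol{u}\in A\boldsymbol{x}\}$. Sums and scalar multiples of set-valued operators are taken pointwise: $(\lambda A+(1-\lambda)\operatorname{Id})\boldsymbol{x}=\{\lambda\boldsymbol{a}+(1-\lambda)\boldsymbol{x} : \boldsymbol{a}\in A\boldsymbol{x}\}$ for $\lambda>0$. For $\lambda=0$, the convention is that $0\cdot f$ is the zero function on $\mathbb{R}^N$ and $0\cdot A$ is the zero operator defined on all of $\mathbb{R}^N$. *)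

(* Defs.v *)
From HB Require Import structures.
From mathcomp Require Import all_boot all_order all_algebra.
From mathcomp Require Import all_classical all_reals all_analysis.

Set Implicit Arguments.
Unset Strict Implicit.
Unset Printing Implicit Defensive.

Import Order.TTheory GRing.Theory Num.Theory.
Import numFieldNormedType.Exports.

Local Open Scope classical_set_scope.
Local Open Scope ring_scope.

Definition proper_ereal (R : realType) (N : nat) (f : 'rV[R]_N -> \bar R) : Prop :=
  (forall x, f x != -oo%E) /\ (exists x, f x != +oo%E).

(* Intended for functions avoiding -oo, so that the right-hand side is never
   of the form +oo - oo; at t = 0 and t = 1 the inequality is trivial because
   0 * +oo = 0 in [\bar R].  The library's [convex_function] only covers
   real-valued functions. *)
Definition ereal_convex (R : realType) (N : nat) (f : 'rV[R]_N -> \bar R) :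
    Prop :=
  forall (t : R) (x y : 'rV[R]_N), 0 <= t <= 1 ->
    (f (t *: x + (1 - t) *: y)%R <= t%:E * f x + (1 - t)%:E * f y)%E.

(* The library norm on ['rV[R]_N] is the sup norm, which induces the same
   topology as the Euclidean one but is not the norm used in [prox]. *)
Definition enorm (R : realType) (N : nat) (x : 'rV[R]_N) : R :=
  Num.sqrt (\sum_(i < N) x ord0 i ^+ 2).

Definition argmin (R : realType) (T : Type) (g : T -> \bar R) : set T :=
  [set u | forall v, (g u <= g v)%E].

Definition setop (R : realType) (N : nat) : Type :=
  'rV[R]_N -> set 'rV[R]_N.

Definition prox (R : realType) (N : nat) (f : 'rV[R]_N -> \bar R) :
    setop R N :=
  fun x => argmin (fun u => (f u + (2^-1 * enorm (u - x) ^+ 2)%:E)%E).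

(* For l = 0 this is the zero function, also where f is +oo, because
   0 * +oo = 0 in [\bar R]. *)
Definition fscale (R : realType) (N : nat) (l : R) (f : 'rV[R]_N -> \bar R) :
    'rV[R]_N -> \bar R :=
  fun x => (l%:E * f x)%E.

Definition op_id (R : realType) (N : nat) : setop R N := fun x => [set x].

Definition op_inv (R : realType) (N : nat) (A : setop R N) : setop R N :=
  fun u => [set x | A x u].

(* 0 A is the zero operator with full domain, even where A x is empty; the
   pointwise image alone would be empty there. *)
Definition op_scale (R : realType) (N : nat) (l : R) (A : setop R N) :
    setop R N :=
  fun x => if l == 0 then [set 0] else [set l *: a | a in A x].

Definition op_add (R : realType) (N : nat) (A B : setop R N) : setop R N :=
  fun x => [set a + b | a in A x & b in B x].

(* Main.v *)
(* For l > 0, Fermat's rule says that u minimizes l f + |. - x|^2 / 2 iff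
   (x - u) / l is a subgradient of f at u.  Since a - u = (x - u) / l for
   a := u + (x - u) / l, this is also the condition for u to belong to
   prox f a, and a is the only point with x = l a + (1 - l) u. *)
Require Import Defs.
From HB Require Import structures.
From mathcomp Require Import all_boot all_order all_algebra.
From mathcomp Require Import all_classical all_reals all_analysis.
From mathcomp Require Import ring lra.
Import Order.TTheory GRing.Theory Num.Theory.
Import numFieldNormedType.Exports.
Local Open Scope classical_set_scope.
Local Open Scope ring_scope.

Definition dot {R : realType} {N : nat} (x y : 'rV[R]_N) : R :=
  \sum_(i < N) x ord0 i * y ord0 i.

(** The inequality lives in [\bar R], so [f u] may be infinite; for proper [f] the set is empty
    wherever [f u] is [+oo]. *)
Definition subgradient {R : realType} {N : nat} (f : 'rV[R]_N -> \bar R)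
    (u : 'rV[R]_N) : set 'rV[R]_N :=
  [set g | forall v, (f u + (dot g (v - u))%:E <= f v)%E].

Lemma sqr_enorm {R : realType} {N : nat} (x : 'rV[R]_N) :
  enorm x ^+ 2 = dot x x.
Proof. by rewrite /enorm sqr_sqrtr// sumr_ge0// => i _; rewrite sqr_ge0. Qed.

Lemma dotxx_ge0 {R : realType} {N : nat} (x : 'rV[R]_N) : 0 <= dot x x.
Proof. by rewrite -sqr_enorm sqr_ge0. Qed.

Lemma dot0r {R : realType} {N : nat} (x : 'rV[R]_N) : dot x 0 = 0.
Proof. by apply: big1 => i _; rewrite mxE mulr0. Qed.

Lemma dotxx_le0 {R : realType} {N : nat} (x : 'rV[R]_N) :
  dot x x <= 0 -> x = 0.
Proof.
move=> x_le0; apply/rowP => i; rewrite mxE; apply/eqP; rewrite -sqrf_eq0.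
rewrite eq_le sqr_ge0 andbT; apply: le_trans x_le0.
rewrite /dot (bigD1 i)//= -expr2 lerDl sumr_ge0// => j _.
by rewrite -expr2 sqr_ge0.
Qed.

Lemma dotZl {R : realType} {N : nat} (a : R) (x y : 'rV[R]_N) :
  dot (a *: x) y = a * dot x y.
Proof. by rewrite /dot mulr_sumr; apply: eq_bigr => i _; rewrite mxE mulrA. Qed.

(** Expansion of the square around [u - x], since the argument is [(u - x) + t (v - u)]. *)
Lemma sqr_enorm_segment {R : realType} {N : nat} (t : R) (u v x : 'rV[R]_N) :
  enorm (t *: v + (1 - t) *: u - x) ^+ 2 =
  enorm (u - x) ^+ 2 - 2 * t * dot (x - u) (v - u)
  + t ^+ 2 * dot (v - u) (v - u).
Proof.
rewrite !sqr_enorm /dot !mulr_sumr -sumrB -big_split/=.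
by apply: eq_bigr => i _; rewrite !mxE; ring.
Qed.

(** Replaces the passage to the limit as [t] tends to 0. *)
Lemma ge0_of_affine_ge0 {R : realType} (a b : R) : 0 <= b ->
  (forall t, 0 < t <= 1 -> 0 <= a + t * b) -> 0 <= a.
Proof.
move=> b_ge0 h; rewrite leNgt; apply/negP => a_lt0.
have d_gt0 : 0 < b - a by lra.
(* The root [- a / b] may exceed 1 or be undefined; enlarging the denominator to [b - a] keeps [t]
   in range and makes the value negative. *)
have /h : 0 < - a / (b - a) <= 1.
  by rewrite divr_gt0 ?oppr_gt0//= ler_pdivrMr//; lra.
have -> : a + - a / (b - a) * b = - (a ^+ 2 / (b - a)).
  by field; rewrite gt_eqF.
rewrite oppr_ge0 leNgt divr_gt0// exprn_even_gt0//=.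
by rewrite lt_eqF.
Qed.

Lemma prox_fscaleP {R : realType} {N : nat} {f : 'rV[R]_N -> \bar R}
    {l : R} {x u : 'rV[R]_N} :
  proper_ereal f -> ereal_convex f -> 0 < l ->
  prox (fscale l f) x u <-> subgradient f u (l^-1 *: (x - u)).
Proof.
move=> [fNy [y fy]] f_convex l_gt0.
have fE v : f v = +oo%E \/ exists r, f v = r%:E.
  by have := fNy v; case: (f v) => [r _|_|//]; [right; exists r|left].
rewrite /prox /argmin /fscale /subgradient /=.
have [fu|[r fu]] := fE u.
  (* If [f u] is [+oo], both sides fail when tested at [y], where [f] is finite. *)
  have [fy'|[s fs]] := fE y; first by rewrite fy' in fy.
  by split=> /(_ y); rewrite fu fs ?gt0_muley ?lte_fin// -?EFinM -?EFinD
    ?addye// leye_eq.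
split=> h v.
- have [->|[s fv]] := fE v; first exact: leey.
  rewrite fu fv -EFinD lee_fin dotZl -subr_ge0.
  rewrite -(pmulr_rge0 _ l_gt0).
  (* Comparing [u] with the point at parameter [t] on the segment towards [v], and bounding [f]
     there by convexity, gives [t] times an affine function of [t] with this slope. *)
  apply: (ge0_of_affine_ge0 _ (2^-1 * dot (v - u) (v - u))).
    by rewrite mulr_ge0 ?dotxx_ge0// invr_ge0.
  move=> t /andP[t_gt0 t_le1].
  have t01 : 0 <= t <= 1 by rewrite ltW.
  have := f_convex t v u t01; have := h (t *: v + (1 - t) *: u).
  rewrite sqr_enorm_segment fu fv.
  (* The value [+oo] would contradict the finite bound from convexity. *)
  have [->|[w ->]] := fE (t *: v + (1 - t) *: u); first by [].
  rewrite -!EFinM -!EFinD !lee_fin => h1 h2.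
  have := ler_wpM2l (ltW l_gt0) h2 => h3.
  rewrite -(pmulr_rge0 _ t_gt0).
  have -> : l * (s - (r + l^-1 * dot (x - u) (v - u))) =
            l * s - l * r - dot (x - u) (v - u).
    by field; rewrite gt_eqF.
  nra.
- have [->|[s fv]] := fE v.
    by rewrite gt0_muley ?lte_fin// addye// leey.
  have := h v; rewrite fu fv -!EFinM -!EFinD !lee_fin dotZl => h1.
  have := ler_wpM2l (ltW l_gt0) h1; rewrite mulrDr mulVKf ?gt_eqF// => h2.
  have := sqr_enorm_segment 1 u v x.
  rewrite scale1r subrr scale0r addr0 => ->.
  have := dotxx_ge0 (v - u).
  lra.
Qed.

Lemma fscale1 {R : realType} {N : nat} (f : 'rV[R]_N -> \bar R) :
  fscale 1 f = f.
Proof. by apply/funext => x; rewrite /fscale mul1e. Qed.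

Lemma prox_fscale0 {R : realType} {N : nat} (f : 'rV[R]_N -> \bar R) :
  prox (fscale 0 f) = @op_id R N.
Proof.
apply/funext => x; apply/seteqP; split=> u; rewrite /prox /argmin /fscale /op_id/=.
(* Only the quadratic term is left, and it vanishes at the competitor [x]. *)
- move=> /(_ x); rewrite !mul0e !add0e lee_fin !sqr_enorm subrr dot0r => h.
  by apply/eqP; rewrite -subr_eq0; apply/eqP/dotxx_le0; lra.
- move=> -> v; rewrite !mul0e !add0e lee_fin !sqr_enorm subrr dot0r mulr0.
  by rewrite mulr_ge0 ?dotxx_ge0// invr_ge0.
Qed.

(** The identity has full domain, so the convention for [l = 0] agrees with the pointwise image;
    this covers the factor [1 - lambda] at [lambda = 1]. *)
Lemma op_scale_id {R : realType} {N : nat} (l : R) (x : 'rV[R]_N) :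
  op_scale l (@op_id R N) x = [set l *: x].
Proof.
rewrite /op_scale /op_id; case: eqP => [->|_]; first by rewrite scale0r.
by rewrite image_set1.
Qed.

Theorem proposition1 (R : realType) (N : nat) (hN : (1 <= N)%N)
    (f : 'rV[R]_N -> \bar R)
    (f_proper : proper_ereal f)
    (f_lsc : lower_semicontinuous f)
    (f_convex : ereal_convex f)
    (lambda : R) (hlambda : 0 <= lambda) :
  prox (fscale lambda f) =
  op_inv (op_add (op_scale lambda (op_inv (prox f)))
                 (op_scale (1 - lambda) (@op_id R N))).
Proof.
apply/funext => x; apply/seteqP.
rewrite /op_inv /op_add; under [X in _ `<=` X]eq_set do rewrite op_scale_id.
under [X in _ /\ X `<=` _]eq_set do rewrite op_scale_id.
have [->|l_neq0] := eqVneq lambda 0.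
  rewrite prox_fscale0 /op_scale eqxx /op_id subr0; split=> u /=.
  - by move=> ->; exists 0 => //; exists x; rewrite ?scale1r ?add0r.
  - by move=> [_ -> [_ -> <-]]; rewrite scale1r add0r.
have l_gt0 : 0 < lambda by rewrite lt_def l_neq0.
(* Fermat's rule with factor 1. *)
have proxP a u : prox f a u <-> subgradient f u (a - u).
  by rewrite -{1}(fscale1 f) prox_fscaleP// invr1 scale1r.
rewrite /op_scale (negbTE l_neq0); split=> u /=.
- move=> /prox_fscaleP -/(_ f_proper f_convex l_gt0) h.
  exists (lambda *: (u + lambda^-1 *: (x - u))).
    exists (u + lambda^-1 *: (x - u)) => //.
    by apply/proxP; rewrite addrAC subrr add0r.
  exists ((1 - lambda) *: u) => //.
  by apply/rowP => i; rewrite !mxE; field.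
(* Here [x] is replaced by [lambda a + (1 - lambda) u], so the required subgradient reduces to
   [a - u]. *)
- move=> [_ [a /proxP h <-] [_ -> <-]]; apply/prox_fscaleP => //.
  suff -> : lambda^-1 *: (lambda *: a + (1 - lambda) *: u - u) = a - u by [].
  by apply/rowP => i; rewrite !mxE; field.
Qed.
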